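(* Let $p\ge 1$ and, for $j=1,\dots,p$, let $A_j$ be a finite set with $m_j\ge 1$ elements; put $\Omega_p=A_1\times\dots\times A_p$. Let $v>0$ and $w>0$. For each $j$, the function $$f(\sigma_j\mid v,w)=\frac{w+1}{m_j^{-(v+w)}\,{}_2F_1\!\left(1,v+w;\,w+2;\,\frac{m_j-1}{m_j}\right)}\left(1+\frac{m_j-1}{\exp(1/\sigma_j)}\right)^{-(v+w)}\exp\!\left(-\frac{w+1}{\sigma_j}\right)\frac{1}{\sigma_j^2},\qquad \sigma_j>0,$$ is the density of a probability distribution on the positive reals, denoted $\mathrm{HIG}(v,w)$, and this distribution is the semi-conjugate prior for $\sigma_j$ in the Hamming model. That is, suppose that, given $\boldsymbol c=(c_1,\dots,c_p)\in\Omega_p$ and $\boldsymbol\sigma=(\sigma_1,\dots,\sigma_p)\in(0,\infty)^p$, the observations $\boldsymbol x_1,\dots,\boldsymbol x_n\in\Omega_p$, $\boldsymbol x_i=(x_{i1},\dots,x_{ip})$, are i.i.d. from the $\mathrm{Hamming}(\boldsymbol c,\boldsymbol\sigma)$ distribution, and that a priori $\sigma_1,\dots,\sigma_p$ are independent of each other and of $\boldsymbol c$ with $\sigma_j\sim\mathrm{HIG}(v,w)$. Then for each $j$ the full conditional distribution of $\sigma_j$ given the data, $\boldsymbol c$ and $(\sigma_k)_{k\ne j}$ is $\mathrm{HIG}(v^\ast,w^\ast)$ with $$v^\ast=v+\sum_{i=1}^n\delta_{c_j}(x_{ij}),\qquad w^\ast=w+n-\sum_{i=1}^n\delta_{c_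j}(x_{ij}).$$
   Context: $\delta_a(b)$ is the Kronecker delta: it equals $1$ if $a=b$ and $0$ otherwise. ${}_2F_1(a,b;c;z)$ is the Gauss hypergeometric function. The $\mathrm{Hamming}(\boldsymbol c,\boldsymbol\sigma)$ distribution on $\Omega_p$, with center $\boldsymbol c\in\Omega_p$ and scale $\boldsymbol\sigma\in(0,\infty)^p$, has probability mass function $$p(\boldsymbol x\mid\boldsymbol c,\boldsymbol\sigma)=\frac{1}{\prod_{j=1}^p\left(1+\frac{m_j-1}{\exp(1/\sigma_j)}\right)}\exp\!\left(-\sum_{j=1}^p\frac{1-\delta_{c_j}(x_j)}{\sigma_j}\right),\qquad \boldsymbol x=(x_1,\dots,x_p)\in\Omega_p.$$ For $m_j$ fixed, $\mathrm{HIG}(v,w)$ depends on $m_j$ although this is not shown in the notation. The acronym stands for Hypergeometric Inverse Gamma. *)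

(* Defs.v *)
From HB Require Import structures.
From mathcomp Require Import all_boot all_order all_algebra.
From mathcomp Require Import all_classical all_reals all_analysis.
From mathcomp Require Import measurable_realfun.

Set Implicit Arguments.
Unset Strict Implicit.
Unset Printing Implicit Defensive.

Import Order.TTheory GRing.Theory Num.Theory.
Import numFieldNormedType.Exports.

Local Open Scope classical_set_scope.
Local Open Scope ring_scope.

(* Pochhammer symbol a (a + 1) ... (a + k - 1) *)
Definition rising {R : realType} (a : R) (k : nat) : R :=
  \prod_(i < k) (a + i%:R).

(* Gauss series; meaningful for `|z| < 1 and c not a nonpositive integer. *)
Definition hyp2F1 {R : realType} (a b c z : R) : R :=
  limn (series (fun k : nat =>
    rising a k * rising b k / (rising c k * k`!%:R) * z ^+ k)).

(* The formula is used for s > 0 only. *)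
Definition HIG_pdf {R : realType} (m : nat) (v w s : R) : R :=
  (w + 1) / (m%:R `^ (- (v + w))
             * hyp2F1 1 (v + w) (w + 2) ((m%:R - 1) / m%:R))
  * (1 + (m%:R - 1) / expR (1 / s)) `^ (- (v + w))
  * expR (- ((w + 1) / s)) * (1 / s ^+ 2).

(* A distribution on (0, +oo) is represented as a distribution on R that
   charges only (0, +oo). *)
Definition HIG {R : realType} (m : nat) (v w : R) (B : set R) : \bar R :=
  (\int[lebesgue_measure]_(s in B `&` `]0%R, +oo[) (HIG_pdf m v w s)%:E)%E.

Definition is_pdf_on_pos {R : realType} (f : R -> R) : Prop :=
  [/\ measurable_fun (`]0, +oo[ : set R) f,
      forall s, 0 < s -> 0 <= f s
    & (\int[lebesgue_measure]_(s in `]0%R, +oo[) (f s)%:E = 1)%E].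

Definition is_probability {R : realType} (K : set R -> \bar R) : Prop :=
  exists Q : probability R R, forall B, measurable B -> Q B = K B.

Definition hamming_pmf {R : realType} {p : nat} {A : 'I_p -> finType}
    (c : {dffun forall j, A j}) (s : 'I_p -> R)
    (x : {dffun forall j, A j}) : R :=
  1 / (\prod_(j < p) (1 + (#|A j|%:R - 1) / expR (1 / s j)))
  * expR (- \sum_(j < p) (1 - (x j == c j)%:R) / s j).

Definition mutually_independent {d : measure_display} {T : measurableType d}
    {R : realType} (P : probability T R) {I : finType}
    (S : I -> set (set T)) : Prop :=
  forall (J : {set I}) (E : I -> set T),
    (forall i, i \in J -> S i (E i)) ->
    P (\bigcap_(i in [set` J]) E i) = (\prod_(i in J) P (E i))%E.

(* q is a version of the conditional probability of E given the sigma-algebra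
   generated by G, a family of measurable sets. *)
Definition is_cond_prob {d : measure_display} {T : measurableType d}
    {R : realType} (P : probability T R) (G : set (set T)) (E : set T)
    (q : T -> \bar R) : Prop :=
  measurable_fun [set: g_sigma_algebraType G] (q : g_sigma_algebraType G -> \bar R)
  /\ forall D, <<s G >> D -> P (E `&` D) = (\int[P]_(t in D) q t)%E.

(* K is a regular conditional distribution of X given <<s G >>. *)
Definition is_cond_distribution {d : measure_display} {T : measurableType d}
    {R : realType} (P : probability T R) (G : set (set T)) (X : T -> R)
    (K : T -> set R -> \bar R) : Prop :=
  (forall t, is_probability (K t)) /\
  forall B, measurable B -> is_cond_prob P G (X @^-1` B) (fun t => K t B).

Definition real_events {d : measure_display} {T : measurableType d}
    {R : realType} (X : T -> R) : set (set T) :=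
  preimage_set_system setT X measurable.

Definition finite_events {d : measure_display} {T : measurableType d}
    {F : finType} (X : T -> F) : set (set T) :=
  preimage_set_system setT X (@discrete_measurable F).

(* Positivity of the sigma j is imposed only almost surely, through their law.
   The prior of the center c is arbitrary. *)
Record hamming_model {R : realType} {p : nat} (A : 'I_p -> finType) (v w : R)
    {d : measure_display} {T : measurableType d} (P : probability T R)
    (sigma : 'I_p -> {RV P >-> R}) (c : T -> {dffun forall j, A j})
    (n : nat) (x : 'I_n -> T -> {dffun forall j, A j}) : Prop := {
  center_measurable : finite_events c `<=` measurable ;
  data_measurable : forall i, finite_events (x i) `<=` measurable ;
  prior_independent : mutually_independent P (fun o : option 'I_p =>
    if o is Some j then real_events (sigma j) else finite_events c) ;
  prior_scale : forall j (B : set R), measurable B ->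
    distribution P (sigma j) B = HIG #|A j| v w B ;
  data_conditionally_iid : forall a : 'I_n -> {dffun forall j, A j},
    is_cond_prob P (finite_events c `|` \bigcup_j real_events (sigma j))
      [set t | forall i, x i t = a i]
      (fun t => (\prod_(i < n) hamming_pmf (c t) (sigma ^~ t) (a i))%:E)
}.

(* Generators of the sigma-algebra of the data, the center and all scales
   but the j-th. *)
Definition full_conditioning {R : realType} {p : nat} {A : 'I_p -> finType}
    {d : measure_display} {T : measurableType d} (sigma : 'I_p -> T -> R)
    (c : T -> {dffun forall j, A j}) (n : nat)
    (x : 'I_n -> T -> {dffun forall j, A j}) (j : 'I_p) : set (set T) :=
  \bigcup_i finite_events (x i) `|` finite_events c
  `|` \bigcup_(k in [set k | k != j]) real_events (sigma k).

(* Main.v *)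
(* With y = exp (-1/s) and k = m - 1 the HIG density is a multiple of
   y^(w+1) (1 + k y)^(-(v+w)) / s^2.  Integrating by parts N times leaves the
   first N terms of the Gauss series and a remainder which, since
   y / (1 + k y) <= 1 / m, is at most (v+w)_N / (w+1)_N ((m-1)/m)^N times the
   integral; this gives the normalizing constant.
   For the posterior, fix the values of the data and of the center.  On that
   event the likelihood is a product of one kernel y^d (1 + k y)^(-n) per
   coordinate.  Kernels multiply by adding exponents, and sigma_j is independent
   of (c, (sigma_k)_(k != j)), so that the factor at j turns the prior of sigma_j
   into a multiple of the posterior, whereas the other factors only contribute a
   constant that does not depend on the event on sigma_j. *)
Require Import Defs.
From HB Require Import structures.
From mathcomp Require Import all_boot all_order all_algebra.
From mathcomp Require Import all_classical all_reals all_analysis.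
From mathcomp Require Import measurable_realfun.
From mathcomp Require Import ring lra.
Import Order.TTheory GRing.Theory Num.Theory.
Import numFieldNormedType.Exports.
Local Open Scope classical_set_scope.
Local Open Scope ring_scope.

(** * Kernels and their derivatives *)

(* exp (-b/s) (1 + k exp (-1/s))^(-a), as a single exponential *)
Definition kern {R : realType} (k b a s : R) : R :=
  expR (- (b / s) - a * ln (1 + k / expR (1 / s))).

Lemma kern_base_gt0 {R : realType} (k s : R) : 0 <= k -> 0 < 1 + k / expR (1 / s).
Proof. by move=> k0; rewrite ltr_wpDr// divr_ge0// expR_ge0. Qed.

Lemma kern_gt0 {R : realType} (k b a s : R) : 0 < kern k b a s.
Proof. exact: expR_gt0. Qed.

Lemma kernE {R : realType} (k b a s : R) : 0 <= k ->
  kern k b a s = (1 + k / expR (1 / s)) `^ (- a) * expR (- (b / s)).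
Proof.
move=> k0; rewrite /kern expRD mulrC; congr (_ * _).
by rewrite /powR gt_eqF ?kern_base_gt0// mulNr.
Qed.

Lemma kernD {R : realType} (k b a b' a' s : R) :
  kern k b a s * kern k b' a' s = kern k (b + b') (a + a') s.
Proof. by rewrite /kern -expRD; congr expR; rewrite !mulrDl; ring. Qed.

(** With y = exp (-1/s) and q = 1 + k y, the exponent has derivative (b - a k y / q) / s^2. Since y
    / q is the kernel with both exponents 1, the second term is again a kernel, with both exponents
    raised by one. *)
Lemma is_derive_kern {R : realType} (k b a s : R) : 0 <= k -> 0 < s ->
  is_derive s 1 (kern k b a)
    ((b * kern k b a s - a * k * kern k (b + 1) (a + 1) s) / s ^+ 2).
Proof.
move=> k0 s0; have sN0 : s != 0 by rewrite gt_eqF.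
have dinv : is_derive s 1 (fun t : R => t^-1) (- s ^- 2).
  have := @is_deriveV _ id s 1 1 sN0 (is_derive_id _ _).
  by rewrite /GRing.scale /= mulr1.
pose e t := expR (- t^-1) : R.
have dN : is_derive s 1 (fun t : R => - t^-1) (s ^- 2).
  by rewrite -[s ^- 2]opprK; exact: is_deriveN dinv.
have de : is_derive s 1 e (e s * s ^- 2).
  exact: (@is_derive1_comp _ expR (fun t => - t^-1) _ _ _ (is_derive_expR _) dN).
have q0 : 0 < 1 + k * e s by rewrite ltr_wpDr// mulr_ge0// expR_ge0.
pose q t := 1 + k * e t.
have dq : is_derive s 1 q (k * (e s * s ^- 2)).
  rewrite -[X in is_derive _ _ _ X]add0r.
  exact: (@is_deriveD R R^o R^o (cst (1 : R)) (k \*: e) _ _ _ _ (is_derive_cst _ _ _)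
    (@is_deriveZ R R^o R^o e k _ _ _ de)).
have dl : is_derive s 1 (fun t => ln (q t)) ((q s)^-1 * (k * (e s * s ^- 2))).
  exact: (@is_derive1_comp _ (@ln R) q _ _ _ (is_derive1_ln q0) dq).
have dx : is_derive s 1 (fun t => - b * t^-1 - a * ln (q t))
    (- b * - s ^- 2 - a * ((q s)^-1 * (k * (e s * s ^- 2)))).
  exact: (@is_deriveB R R^o R^o _ _ _ _ _ _
    (@is_deriveZ R R^o R^o _ (- b) _ _ _ dinv) (@is_deriveZ R R^o R^o _ a _ _ _ dl)).
have dd := @is_derive1_comp _ expR _ _ _ _ (is_derive_expR _) dx.
have kE t : kern k b a t = expR (- b * t^-1 - a * ln (q t)).
  by rewrite /kern /q /e expRN div1r mulNr.
rewrite (_ : kern k b a = expR \o (fun t => - b * t^-1 - a * ln (q t))); last first.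
  exact/funext.
apply: is_derive_eq; rewrite -kE.
suff -> : kern k (b + 1) (a + 1) s = kern k b a s * (e s / q s).
  by rewrite /comp -kE; field; rewrite sN0 gt_eqF.
rewrite -(kernD _ b a 1 1); congr (_ * _).
by rewrite /kern !div1r mul1r expRD -expRN -/(e s) expRN lnK.
Qed.

(** * Rising factorials and the telescoping antiderivative *)

Lemma rising0 {R : realType} (a : R) : rising a 0 = 1.
Proof. by rewrite /rising big_ord0. Qed.

Lemma risingS {R : realType} (a : R) n : rising a n.+1 = rising a n * (a + n%:R).
Proof. by rewrite /rising big_ord_recr. Qed.

Lemma rising_gt0 {R : realType} (a : R) n : 0 < a -> 0 < rising a n.
Proof. by move=> a0; apply: prodr_gt0 => i _; rewrite ltr_wpDr. Qed.

Lemma rising1 {R : realType} n : rising (1 : R) n = n`!%:R.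
Proof.
elim: n => [|n IH]; first by rewrite rising0.
by rewrite risingS IH factS mulnC natrM nat1r.
Qed.

Lemma risingSl {R : realType} (a : R) n : rising a n.+1 = a * rising (a + 1) n.
Proof.
rewrite /rising big_ord_recl addr0; congr (_ * _); apply: eq_bigr => i _.
by rewrite lift0 -nat1r addrA.
Qed.

(* What N integrations by parts produce: the derivatives of the terms telescope. *)
Definition antider {R : realType} (k b a : R) N (s : R) : R :=
  \sum_(n < N) (k ^+ n * rising a n / rising b n.+1) * kern k (b + n%:R) (a + n%:R) s.

(** Induction on [N]: the factor b + N in [rising b N.+1] makes the first part of the derivative of
    the new term cancel the remainder left so far, and the second part is the next remainder. *)
Lemma is_derive_antider {R : realType} (k b a s : R) N : 0 <= k -> 0 < b -> 0 < s ->
  is_derive s 1 (antider k b a N)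
   ((kern k b a s -
     k ^+ N * rising a N / rising b N * kern k (b + N%:R) (a + N%:R) s) / s ^+ 2).
Proof.
move=> k0 b0 s0; elim: N => [|N IH].
  rewrite (_ : antider k b a 0 = cst 0); last first.
    by apply/funext => t; rewrite /antider big_ord0.
  by apply: is_derive_eq; rewrite expr0 !rising0 !addr0; field; rewrite gt_eqF.
rewrite (_ : antider _ _ _ _ = antider k b a N + (k ^+ N * rising a N / rising b N.+1) \*:
     kern k (b + N%:R) (a + N%:R)); last first.
  by apply/funext => t; rewrite /antider big_ord_recr.
have := is_deriveD IH (is_deriveZ (k ^+ N * rising a N / rising b N.+1)
   (is_derive_kern k (b + N%:R) (a + N%:R) s k0 s0)).
move/is_derive_eq; apply.
rewrite /GRing.scale /= -!addrA !natr1 !risingS [k ^+ N.+1]exprS.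
move: (kern k b a s) (kern _ _ _ s) (kern _ _ _ s) => x y z.
field; rewrite !gt_eqF ?rising_gt0//.
by rewrite ltr_wpDr.
Qed.

(** * Improper integration, and limits of kernels at both ends of the half-line *)

(** The half-line is exhausted by the rays [1/(n+1), +oo[. On each of them the fundamental theorem
    gives l - F (1/(n+1)); monotone convergence and the limit of [F] at 0+ conclude. *)
Lemma ge0_FTC_oo {R : realType} (f F : R -> R) (l0 l : R) :
  (forall s : R, 0 < s -> 0 <= f s) -> (forall s : R, 0 < s -> is_derive s 1 F (f s)) ->
  (forall s : R, 0 < s -> {for s, continuous f}) ->
  F s @[s --> +oo%R] --> l -> F s @[s --> 0^'+] --> l0 ->
  (\int[lebesgue_measure]_(s in `]0%R, +oo[) (f s)%:E = (l - l0)%:E)%E.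
Proof.
move=> f0 dF cf Fl Fl0.
pose a n : R := n.+1%:R^-1.
have a0 n : 0 < a n by rewrite invr_gt0.
have cF (s : R) : 0 < s -> {for s, continuous F}.
  move=> s0; apply: differentiable_continuous; apply/derivable1_diffP.
  by case: (dF _ s0).
have intE n : (\int[lebesgue_measure]_(s in `[a n, +oo[) (f s)%:E =
    (l - F (a n))%:E)%E.
  rewrite (@ge0_continuous_FTC2y _ f F _ l)//.
  - by move=> x ax; apply: f0; exact: lt_le_trans ax.
  - apply/continuous_within_itvcyP; split.
      move=> x; rewrite in_itv/= andbT => ax; apply: cf; exact: lt_trans ax.
    by apply: cvg_at_right_filter; exact: cf.
  - by move=> x ax; case: (dF x) => //; exact: lt_trans ax.
  - by apply: cvg_at_right_filter; exact: cF.
  - move=> x; rewrite in_itv/= andbT => ax.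
    have := dF x (lt_trans (a0 n) ax) => -[_].
    by rewrite derive1E.
have -> : `]0%R, +oo[%classic = \bigcup_n `[a n, +oo[%classic.
  apply/seteqP; split => x /=; rewrite in_itv/= andbT.
    move=> x0; have [n _ xn] : exists2 n, True & x^-1 <= n.+1%:R.
      exists (Num.truncn x^-1) => //.
      by rewrite ltW// truncnS_gt.
    exists n => //=; rewrite in_itv/= andbT /a.
    by rewrite invf_ple// posrE.
  by move=> [n _] /=; rewrite in_itv/= andbT; exact: lt_le_trans.
have mf n : measurable_fun `[a n, +oo[%classic (EFin \o f).
  apply/measurable_EFinP/measurable_fun_itv_obnd_cbndP.
  apply: open_continuous_measurable_fun => // x.
  by rewrite inE/= in_itv/= andbT => ax; apply: cf; exact: lt_trans ax.
have : (\int[lebesgue_measure]_(s in `[a n, +oo[) (f s)%:E @[n --> \oo] -->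
    \int[lebesgue_measure]_(s in \bigcup_n `[a n, +oo[%classic) (f s)%:E)%E.
  apply: ge0_nondecreasing_set_cvg_integral => //.
  - apply/nondecreasing_seqP => n; apply/subsetPset => x /=.
    rewrite !in_itv/= !andbT; apply: le_trans.
    by rewrite lef_pV2// ?posrE// ler_nat.
  - move=> n x /=; rewrite in_itv/= andbT => ax.
    by rewrite lee_fin f0//; exact: lt_le_trans ax.
move/cvg_lim => <- //.
under eq_fun do rewrite /= intE.
apply/cvg_lim => //; apply: cvg_EFin; first exact: nearW.
rewrite (_ : fine \o _ = (fun n => l - F (a n))); last exact/funext.
apply: cvgB; first exact: cvg_cst.
have := (cvg_at_rightP F 0 l0).1 Fl0 a; apply; split => //.
exact: cvg_harmonic.
Qed.

(** The substitution u = 1/s turns the limit at infinity into continuity of [G] at 0. *)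
Lemma kern_cvgy {R : realType} (k b a : R) : 0 <= k ->
  kern k b a s @[s --> +oo%R] --> (1 + k) `^ (- a).
Proof.
move=> k0.
have k1 : 0 < 1 + k by rewrite ltr_wpDr.
pose G (u : R) := expR (- b * u - a * ln (1 + k * expR (- u))).
have cV : (s^-1 : R) @[s --> +oo%R] --> (0 : R).
  apply/gtr0_cvgV0 => //.
  by near=> x.
have -> : kern k b a = G \o GRing.inv.
  by apply/funext => s; rewrite /kern /G /= expRN div1r mulNr.
have -> : (1 + k) `^ (- a) = G 0.
  rewrite /G oppr0 expR0 mulr0 mulr1 add0r /powR gt_eqF// mulNr //.
apply: (cvg_comp _ _ cV).
have cE : expR (- u) @[u --> (0:R)] --> expR (- 0 : R).
  by apply: continuous_cvg; [exact: continuous_expR|apply: cvgN; exact: cvg_id].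
apply: continuous_cvg; first exact: continuous_expR.
apply: cvgB; first by apply: cvgMr; exact: cvg_id.
apply: cvgMr; apply: continuous_cvg.
  by apply: continuous_ln; rewrite oppr0 expR0 mulr1.
by apply: cvgD; [exact: cvg_cst|apply: cvgMr].
Unshelve. all: by end_near. Qed.

(** The base 1 + k exp (-1/s) is at least 1 and a >= 0, so the kernel lies between 0 and exp
    (-b/s). *)
Lemma kern_cvg0 {R : realType} (k b a : R) : 0 <= k -> 0 < b -> 0 <= a ->
  kern k b a s @[s --> 0^'+] --> 0.
Proof.
move=> k0 b0 a0.
have cb : expR (- (b / s)) @[s --> (0 : R)^'+] --> (0 : R).
  apply: (@cvg_comp _ _ _ (fun s : R => b / s) (fun u => expR (- u)) _ (pinfty_nbhs R));
    last exact: cvgr_expR.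
  apply: gt0_cvgMry => //.
  apply/cvgrVy; last by apply: cvg_at_right_filter; exact: cvg_id.
  exact: nbhs_right_gt.
apply: (squeeze_cvgr _ (cvg_cst 0) cb); near=> s.
rewrite ltW ?kern_gt0//= ler_expR lerBlDr lerDl mulr_ge0//.
by rewrite ln_ge0// lerDl divr_ge0// expR_ge0.
Unshelve. all: by end_near. Qed.

(** * Decay of the remainder *)

Lemma ratio_cvg0 {R : realType} (u : nat -> R) (r : R) (N : nat) :
  (forall n, 0 <= u n) -> 0 <= r < 1 ->
  (forall n, (N <= n)%N -> u n.+1 <= r * u n) -> u n @[n --> \oo] --> 0.
Proof.
move=> u0 /andP[r0 r1] ur; rewrite -(cvg_shiftn N).
have rc : geometric (u N) r n @[n --> \oo] --> 0.
  by apply: cvg_geometric; rewrite ger0_norm.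
apply: (squeeze_cvgr _ (cvg_cst 0) rc); apply: nearW => n; rewrite u0/=.
elim: n => [|n IH]; first by rewrite add0n /= expr0 mulr1.
rewrite addSn (le_trans (ur _ _)) ?leq_addl//= exprS mulrCA.
by rewrite ler_wpM2l.
Qed.

(** Consecutive terms have ratio z (a + n) / (b + n), which tends to z and is therefore eventually
    at most the midpoint [r] of z and 1. *)
Lemma rising_ratio_cvg0 {R : realType} (a b z : R) : 0 < a -> 0 < b -> 0 <= z < 1 ->
  rising a n / rising b n * z ^+ n @[n --> \oo] --> 0.
Proof.
move=> a0 b0 /andP[z0 z1].
pose r := (1 + z) / 2.
have zr : 0 < r - z by rewrite /r; lra.
(* From this rank on a <= (r - z) n, hence z (a + n) <= a + z n <= r n <= r (b + n). *)
apply: (@ratio_cvg0 _ _ r (Num.truncn (a / (r - z))).+1).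
- by move=> n; rewrite mulr_ge0 ?exprn_ge0// divr_ge0// ltW// rising_gt0.
- by rewrite /r; lra.
move=> n nN; rewrite !risingS exprS.
have ra : 0 < rising a n by exact: rising_gt0.
have rb : 0 < rising b n by exact: rising_gt0.
have bn : 0 < b + n%:R by rewrite ltr_wpDr.
have -> : rising a n * (a + n%:R) / (rising b n * (b + n%:R)) * (z * z ^+ n) =
   ((a + n%:R) / (b + n%:R) * z) * (rising a n / rising b n * z ^+ n).
  by field; rewrite !gt_eqF.
rewrite ler_wpM2r//.
  by rewrite mulr_ge0 ?exprn_ge0// divr_ge0// ltW.
rewrite mulrAC ler_pdivrMr//.
have an : a <= (r - z) * n%:R.
  rewrite mulrC -ler_pdivrMr// (le_trans (ltW (truncnS_gt _)))//.
  by rewrite ler_nat.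
have z1' : a * z <= a by rewrite ler_piMr// ltW.
have r0 : 0 <= r * b by rewrite mulr_ge0 ?(ltW b0)// /r; lra.
by nra.
Qed.

(** As exp (-1/s) <= 1, the quotient exp (-1/s) / (1 + k exp (-1/s)) is at most 1 / (1 + k); the
    kernel is its n-th power. *)
Lemma kern_le {R : realType} (k s : R) n : 0 <= k -> 0 < s ->
  kern k n%:R n%:R s <= (1 + k) ^- n.
Proof.
move=> k0 s0.
have k1 : 0 < 1 + k by rewrite ltr_wpDr.
have q0 := kern_base_gt0 k s k0.
have -> : (1 + k) ^- n = expR (- (n%:R * ln (1 + k))).
  by rewrite expRN mulrC expRM_natr lnK.
rewrite /kern ler_expR -opprD lerN2 (_ : n%:R / s = n%:R * (1 / s)) ?div1r//.
rewrite -mulrDr ler_wpM2l// -div1r.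
rewrite -[X in _ <= X + _]expRK -lnM ?posrE ?expR_gt0// ler_ln ?posrE ?mulr_gt0 ?expR_gt0//.
rewrite mulrDr mulr1 mulrCA divff ?mulr1 ?gt_eqF ?expR_gt0// lerD2r.
by rewrite -expR0 ler_expR divr_ge0// ltW.
Qed.

(** * Measurability, finite sums of limits, and continuity *)

Lemma measurable_inv {R : realType} (D : set R) : measurable_fun D (@GRing.inv R).
Proof.
(* This identity also holds at 0, where the inverse is 0 by convention; real powers are
   measurable. *)
apply: measurable_funTS; rewrite (_ : GRing.inv = fun x => x * (x ^+ 2) `^ (-1)).
  apply: measurable_funM => //.
  by apply: (measurableT_comp (measurable_powR (-1 : R))); exact: exprn_measurable.
apply/funext => x; rewrite powR_inv1 ?sqr_ge0//.
have [->|x0] := eqVneq x 0; first by rewrite invr0 mul0r.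
by field.
Qed.

Lemma measurable_kern {R : realType} (k b a : R) D : measurable_fun D (kern k b a).
Proof.
apply: measurable_funTS; apply: measurableT_comp; first exact: measurable_expR.
have mi : measurable_fun setT (fun s : R => 1 / s).
  by apply: measurable_funM => //; exact: measurable_inv.
apply: measurable_funB.
  apply: measurable_funN; apply: measurable_funM => //; exact: measurable_inv.
apply: measurable_funM => //; apply: measurableT_comp; first exact: measurable_ln.
apply: measurable_funD => //; apply: measurable_funM => //.
apply: measurableT_comp; first exact: measurable_inv.
by apply: measurableT_comp => //; exact: measurable_expR.
Qed.

Lemma cvg_fin_sum {R : realType} (I : finType) (F : set_system R) {FF : Filter F}
    (f : I -> R -> R) (l : I -> R) :
  (forall i, f i x @[x --> F] --> l i) ->
  \sum_i f i x @[x --> F] --> \sum_i l i.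
Proof.
move=> fl; elim: (index_enum I) => [|i r IH].
  by rewrite big_nil; under eq_cvg do rewrite big_nil; exact: cvg_cst.
by rewrite big_cons; under eq_cvg do rewrite big_cons; exact: cvgD.
Qed.

Lemma continuous_kern {R : realType} (k b a s : R) : 0 <= k -> 0 < s ->
  {for s, continuous (kern k b a)}.
Proof.
move=> k0 s0; apply: differentiable_continuous; apply/derivable1_diffP.
by case: (is_derive_kern k b a s k0 s0).
Qed.

(** * The integral of a kernel as a Gauss series *)

Definition gauss_term {R : realType} (a b c z : R) (i : nat) : R :=
  rising a i * rising b i / (rising c i * i`!%:R) * z ^+ i.

(** The i-th kernel tends to (1 + k)^(-(a + i)). By (b)_(i+1) = b (b+1)_i and (1)_i = i!, each
    summand becomes (1 + k)^(-a) / b times a Gauss term at k / (1 + k). *)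
Lemma antider_cvgy {R : realType} (k b a : R) N : 0 <= k -> 0 < b ->
  antider k b a N s @[s --> +oo%R] -->
    (1 + k) `^ (- a) / b * series (gauss_term 1 a (b + 1) (k / (1 + k))) N.
Proof.
move=> k0 b0.
have k1 : 0 < 1 + k by rewrite ltr_wpDr.
rewrite /series /= big_mkord mulr_sumr.
have -> : \sum_(i < N) (1 + k) `^ (- a) / b * gauss_term 1 a (b + 1) (k / (1 + k)) i
  = \sum_(i < N) k ^+ i * rising a i / rising b i.+1 * (1 + k) `^ (- (a + i%:R)).
  apply: eq_bigr => i _; rewrite /gauss_term rising1 risingSl.
  rewrite opprD powRD ?(gt_eqF k1) ?implybT// [_ `^ (- i%:R)]powRN.
  rewrite powR_mulrn ?ltW// exprMn exprVn.
  have b1 : 0 < b + 1 by rewrite addr_gt0.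
  by field; rewrite ?gt_eqF ?exprn_gt0 ?rising_gt0 ?ltr0n ?fact_gt0 ?powR_gt0.
rewrite /antider; apply: cvg_fin_sum => i.
by apply: cvgMr; exact: kern_cvgy.
Qed.


Lemma antider_cvg0 {R : realType} (k b a : R) N : 0 <= k -> 0 < b -> 0 <= a ->
  antider k b a N s @[s --> 0^'+] --> 0.
Proof.
move=> k0 b0 a0; rewrite [X in _ --> X](_ : 0 = \sum_(i < N)
   (k ^+ i * rising a i / rising b i.+1) * 0); last first.
  by rewrite big1// => i _; rewrite mulr0.
rewrite /antider; apply: cvg_fin_sum => i.
apply: cvgMr; apply: kern_cvg0 => //.
  by rewrite ltr_wpDr.
by rewrite addr_ge0.
Qed.

(** The partial sums satisfy (1 - eps N) J <= C S N <= J, where J is the integral and eps N tends to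
    0. Convergence of the Gauss series is obtained together with its value. *)
Lemma integral_kern {R : realType} (k b a : R) : 0 <= k -> 0 < b -> 0 < a ->
  (\int[lebesgue_measure]_(s in `]0%R, +oo[) (kern k b a s / s ^+ 2)%:E =
   ((1 + k) `^ (- a) / b * hyp2F1 1 a (b + 1) (k / (1 + k)))%:E)%E /\
  0 < hyp2F1 1 a (b + 1) (k / (1 + k)).
Proof.
move=> k0 b0 a0.
have k1 : 0 < 1 + k by rewrite ltr_wpDr.
pose z := k / (1 + k).
have z01 : 0 <= z < 1.
  by rewrite divr_ge0 ?(ltW k1)//= ltr_pdivrMr// mul1r ltrDr.
pose eps N := rising a N / rising b N * z ^+ N.
have eps0 N : 0 <= eps N.
  by rewrite mulr_ge0 ?exprn_ge0 ?divr_ge0// ?ltW ?rising_gt0//; case/andP: z01.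
have epsc : eps N @[N --> \oo] --> 0 by exact: rising_ratio_cvg0.
pose c N := k ^+ N * rising a N / rising b N.
have c0 N : 0 <= c N.
  by rewrite divr_ge0 ?mulr_ge0 ?exprn_ge0// ltW// rising_gt0.
pose C := (1 + k) `^ (- a) / b.
have C0 : 0 < C by rewrite divr_gt0// powR_gt0.
pose S := series (gauss_term 1 a (b + 1) z).
pose f s := kern k b a s / s ^+ 2.
pose f_ N s := (kern k b a s - c N * kern k (b + N%:R) (a + N%:R) s) / s ^+ 2.
have f0 s : 0 <= f s by rewrite divr_ge0 ?sqr_ge0// ltW// kern_gt0.
have ckern0 N s : 0 <= c N * kern k (b + N%:R) (a + N%:R) s.
  by rewrite mulr_ge0// ltW// kern_gt0.
(* The subtracted kernel is [kern k b a] times the kernel with both exponents N; the bound on the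
   latter makes the remainder at most eps N times [f]. *)
have fE N (s : R) : 0 < s -> (1 - eps N) * f s <= f_ N s <= f s.
  move=> s0; rewrite /f_ /f mulrA; have s2 : 0 < (s ^+ 2)^-1 by rewrite invr_gt0 exprn_gt0.
  rewrite !ler_pM2r// gerBl ckern0 andbT mulrBl mul1r lerB//.
  rewrite -(kernD k b a) mulrCA mulrC ler_wpM2r//; first by rewrite ltW// kern_gt0.
  rewrite (le_trans (ler_wpM2l (c0 N) (kern_le k s N k0 s0)))//.
  rewrite /eps /c /z exprMn exprVn le_eqVlt; apply/orP; left; apply/eqP.
  by field; rewrite !gt_eqF ?rising_gt0 ?exprn_gt0.
have mf : measurable_fun (`]0, +oo[ : set R) (EFin \o f).
  apply/measurable_EFinP; apply: measurable_funM; first exact: measurable_kern.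
  by apply: measurableT_comp; [exact: measurable_inv|exact: exprn_measurable].
have mf_ N : measurable_fun (`]0, +oo[ : set R) (EFin \o f_ N).
  apply/measurable_EFinP; apply: measurable_funM.
    apply: measurable_funB; first exact: measurable_kern.
    by apply: measurable_funM => //; exact: measurable_kern.
  by apply: measurableT_comp; [exact: measurable_inv|exact: exprn_measurable].
set J := (integral _ _ _).
have J0 : (0 <= J)%E by apply: integral_ge0 => s _; rewrite lee_fin f0.
(* The condition eps N <= 1 makes [f_ N] nonnegative, as [ge0_FTC_oo] demands. *)
have SE N : eps N <= 1 -> (\int[lebesgue_measure]_(s in `]0%R, +oo[) (f_ N s)%:E =
    (C * S N)%:E)%E.
  move=> e1; rewrite -[C * S N]subr0.
  apply: (@ge0_FTC_oo _ _ (antider k b a N)).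
  - move=> s s0; apply: le_trans (proj1 (andP (fE N s s0))).
    by rewrite mulr_ge0// subr_ge0.
  - by move=> s s0; exact: is_derive_antider.
  - move=> s s0; apply: cvgM.
      apply: cvgB; first exact: continuous_kern.
      by apply: cvgMr; exact: continuous_kern.
    apply: cvgV; first by rewrite gt_eqF// exprn_gt0.
    exact: exprn_continuous.
  - exact: antider_cvgy.
  - by apply: antider_cvg0 => //; exact: ltW.
have SJ N : eps N <= 1 -> ((1 - eps N)%:E * J <= (C * S N)%:E <= J)%E.
  move=> e1; rewrite -SE// -ge0_integralZl//=; last 2 first.
  - by move=> s _; rewrite lee_fin f0.
  - by rewrite lee_fin subr_ge0.
  apply/andP; split; apply: ge0_le_integral => //=.
  - by move=> s _; rewrite mule_ge0// lee_fin ?subr_ge0// f0.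
  - exact: emeasurable_funM.
  - exact: mf_.
  - move=> s; rewrite in_itv/= andbT => s0.
    by rewrite -EFinM lee_fin; case/andP: (fE N s s0).
  - move=> s; rewrite in_itv/= andbT => s0; rewrite lee_fin.
    apply: le_trans (proj1 (andP (fE N s s0))).
    by rewrite mulr_ge0// subr_ge0.
  - exact: mf_.
  - move=> s; rewrite in_itv/= andbT => s0; rewrite lee_fin.
    by case/andP: (fE N s s0).
have eh : \forall N \near \oo, eps N <= 2^-1.
  by apply: (cvgr_le _ epsc); rewrite invr_gt0.
(* If J were infinite, (1 - eps N) J with eps N <= 1/2 would be infinite and yet at most the real
   number C S N. *)
have [r JE] : exists r, J = r%:E.
  have [N _ /(_ N (leqnn N)) eN] := eh.
  have e1 : eps N <= 1 by lra.
  have := SJ N e1.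
  case: (J) J0 => [r _ _|_ /andP[+ _]|//]; first by exists r.
  rewrite mulry gtr0_sg ?mul1e//; lra.
have SJr : \forall N \near \oo, (1 - eps N) * r <= C * S N <= r.
  near=> N; have : eps N <= 1.
    have : eps N <= 2^-1 by near: N.
    by move=> ?; lra.
  by move/SJ; rewrite JE -EFinM !lee_fin.
have Sr : C * S N @[N --> \oo] --> r.
  apply: (squeeze_cvgr SJr); last exact: cvg_cst.
  rewrite -[X in _ --> X]mul1r; apply: cvgMl.
  by rewrite -[X in _ --> X]subr0; apply: cvgB => //; exact: cvg_cst.
have Sr' : S N @[N --> \oo] --> r / C.
  rewrite (_ : S = (fun N => (C * S N) * C^-1)); first exact: cvgMl.
  by apply/funext => N; rewrite mulrAC mulfV ?mul1r// gt_eqF.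
have hE : hyp2F1 1 a (b + 1) z = r / C by apply/cvg_lim.
rewrite hE -/C JE; split; first by rewrite mulrCA mulfV ?mulr1// gt_eqF.
(* A positive N puts the term of index 0, which is 1, into the partial sum; the other terms are
   nonnegative. *)
have [N [N0 +]] : exists N, (0 < N)%N /\ (1 - eps N) * r <= C * S N <= r.
  have [N _ NP] := SJr; exists N.+1; split => //; apply: NP => /=; exact: leqnSn.
case/andP => _ SNr; rewrite divr_gt0//; apply: lt_le_trans SNr.
rewrite mulr_gt0// /S /series /= big_mkord; case: N N0 => // N _.
rewrite big_ord_recl ltr_wpDr//.
  apply: sumr_ge0 => i _; rewrite /gauss_term mulr_ge0 ?exprn_ge0//; last by case/andP: z01.
  by rewrite divr_ge0 ?mulr_ge0 ?ler0n ?ltW ?rising_gt0 ?addr_gt0.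
by rewrite /gauss_term !rising0 expr0 fact0 !mulr1 invr1.
Unshelve. all: by end_near. Qed.

(** * Normalization of the HIG density *)

Definition HIG_const {R : realType} (m : nat) (v w : R) : R :=
  (w + 1) / (m%:R `^ (- (v + w))
             * hyp2F1 1 (v + w) (w + 2) ((m%:R - 1) / m%:R)).

Lemma HIG_pdfE {R : realType} (m : nat) (v w s : R) : (0 < m)%N ->
  HIG_pdf m v w s = HIG_const m v w * (kern (m%:R - 1) (w + 1) (v + w) s / s ^+ 2).
Proof.
move=> m0; rewrite /HIG_pdf -/(HIG_const m v w) kernE ?subr_ge0 ?ler1n//.
by rewrite (div1r (s ^+ 2)) !mulrA.
Qed.

Lemma integral_HIG_kern {R : realType} (m : nat) (v w : R) : (0 < m)%N -> 0 < v -> 0 < w ->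
  0 < HIG_const m v w /\
  (\int[lebesgue_measure]_(s in `]0%R, +oo[) (kern (m%:R - 1) (w + 1) (v + w) s / s ^+ 2)%:E
    = ((HIG_const m v w)^-1)%:E)%E.
Proof.
move=> m0 v0 w0; have m1 : 0 <= m%:R - 1 :> R by rewrite subr_ge0 ler1n.
have w1 : 0 < w + 1 by rewrite addr_gt0.
have vw : 0 < v + w by rewrite addr_gt0.
have [] := integral_kern _ _ _ m1 w1 vw.
rewrite (addrC 1) subrK -(addrA w) (_ : 1 + 1 = 2)// => -> h0.
have mv : 0 < m%:R `^ (- (v + w)) :> R by apply: powR_gt0; rewrite ltr0n.
split; first by rewrite divr_gt0// mulr_gt0.
by congr EFin; rewrite /HIG_const; field; rewrite !gt_eqF.
Qed.

Lemma measurable_HIG_pdf {R : realType} (m : nat) (v w : R) D : (0 < m)%N ->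
  measurable_fun D (HIG_pdf m v w).
Proof.
move=> m0; rewrite (_ : HIG_pdf m v w = fun s => HIG_const m v w *
   (kern (m%:R - 1) (w + 1) (v + w) s / s ^+ 2)); last first.
  by apply/funext => s; exact: HIG_pdfE.
apply: measurable_funM => //; apply: measurable_funM; first exact: measurable_kern.
by apply: measurableT_comp; [exact: measurable_inv|exact: exprn_measurable].
Qed.

Lemma HIG_pdf_ge0 {R : realType} (m : nat) (v w s : R) : (0 < m)%N -> 0 < v -> 0 < w ->
  0 <= HIG_pdf m v w s.
Proof.
move=> m0 v0 w0; rewrite HIG_pdfE// mulr_ge0//.
  by case: (integral_HIG_kern m v w m0 v0 w0) => /ltW.
by rewrite divr_ge0 ?sqr_ge0// ltW// kern_gt0.
Qed.

Lemma HIG_is_pdf {R : realType} (m : nat) (v w : R) : (0 < m)%N -> 0 < v -> 0 < w ->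
  is_pdf_on_pos (HIG_pdf m v w).
Proof.
move=> m0 v0 w0; split; first exact: measurable_HIG_pdf.
  by move=> s _; exact: HIG_pdf_ge0.
have [C0 CE] := integral_HIG_kern m v w m0 v0 w0.
under eq_integral do rewrite HIG_pdfE// EFinM.
rewrite ge0_integralZl//=.
- by rewrite CE -EFinM mulfV// gt_eqF.
- apply/measurable_EFinP; apply: measurable_funM; first exact: measurable_kern.
  by apply: measurableT_comp; [exact: measurable_inv|exact: exprn_measurable].
- by move=> s _; rewrite lee_fin divr_ge0 ?sqr_ge0// ltW// kern_gt0.
- by rewrite lee_fin ltW.
Qed.

Lemma HIG_probability {R : realType} (m : nat) (v w : R) : (0 < m)%N -> 0 < v -> 0 < w ->
  is_probability (HIG m v w).
Proof.
move=> m0 v0 w0.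
have [mf f0 f1] := HIG_is_pdf m v w m0 v0 w0.
pose mu : set R -> \bar R := HIG m v w.
have mu0 : mu set0 = 0%E by rewrite /mu /HIG set0I integral_set0.
have mu_ge0 A : (0 <= mu A)%E.
  by apply: integral_ge0 => s _; rewrite lee_fin HIG_pdf_ge0.
have mu_sa : semi_sigma_additive mu.
  move=> F mF tF mUF; rewrite /mu /HIG setI_bigcupl; apply: cvg_toP.
    apply: ereal_nondecreasing_is_cvgn => i j ij.
    by apply: lee_sum_nneg_natr => // h _ _; exact: mu_ge0.
  rewrite ge0_integral_bigcup//=.
  - move=> i; apply: measurableI; first exact: mF.
    exact: measurable_itv.
  - by apply/measurable_EFinP; exact: measurable_HIG_pdf.
  - by move=> s _; rewrite lee_fin HIG_pdf_ge0.
  - exact: trivIset_setIr.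
pose mum := isMeasure.Build _ _ _ mu mu0 mu_ge0 mu_sa.
pose M : {measure set R -> \bar R} := HB.pack mu mum.
have muT : M setT = 1%E by rewrite /M /= /mu /HIG setTI.
pose mup := Measure_isProbability.Build _ _ _ M muT.
pose Q : probability R R := HB.pack mu mum mup.
by exists Q.
Qed.

(** * Integration against a density, and the update of the prior by a kernel *)

(** The function [f] cut off outside [D] is almost everywhere the Radon-Nikodym derivative of [nu],
    since both have the same integrals over measurable sets; the change of variables for that
    derivative then applies. *)
Lemma integral_density {d : measure_display} {T : measurableType d} {R : realType}
    (nu : {finite_measure set T -> \bar R}) (mu : {sigma_finite_measure set T -> \bar R})
    (D : set T) (f : T -> R) :
  measurable D -> measurable_fun setT f -> (forall x, 0 <= f x) ->
  (forall B, measurable B -> nu B = (\int[mu]_(x in B `&` D) (f x)%:E)%E) ->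
  forall (B : set T) (g : T -> \bar R), measurable B -> measurable_fun setT g ->
    (forall x, (0 <= g x)%E) ->
  (\int[nu]_(x in B) g x = \int[mu]_(x in B `&` D) (g x * (f x)%:E))%E.
Proof.
move=> mD mf f0 nuE B g mB mg g0.
have mEf : measurable_fun setT (EFin \o f) by exact/measurable_EFinP.
have numu : nu `<< mu.
  apply/null_content_dominatesP => A mA muA0; rewrite nuE//.
  apply: null_set_integral; first exact: measurableI.
    exact: measurable_funTS.
  apply/eqP; rewrite eq_le measure_ge0 andbT -muA0.
  by apply: le_measure; rewrite ?inE//; exact: measurableI.
pose h := (EFin \o f) \_ D.
have mh : measurable_fun setT h by apply/(measurable_restrictT _ mD); exact: measurable_funTS.
have rn : ae_eq mu setT (Radon_Nikodym_SigmaFinite.f nu mu) h.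
  apply: integral_ae_eq => //; first exact: Radon_Nikodym_SigmaFinite.f_integrable.
  move=> E _ mE; rewrite -Radon_Nikodym_SigmaFinite.f_integral// nuE//.
  by rewrite integral_mkcondr.
rewrite -(Radon_Nikodym_SigmaFinite.change_of_variables numu)//; last exact: measurable_funTS.
transitivity (\int[mu]_(x in B) (g x * h x))%E.
  apply: ae_eq_integral => //.
  - apply: emeasurable_funM; first exact: measurable_funTS.
    apply: measurable_funTS; apply: (measurable_int mu).
    exact: Radon_Nikodym_SigmaFinite.f_integrable.
  - by apply: emeasurable_funM; exact: measurable_funTS.
  - apply: ae_eqe_mul2l; exact: ae_eq_subset rn.
rewrite integral_mkcondr; apply: eq_integral => x _.
by rewrite /h !patchE; case: ifP => //; rewrite mule0.
Qed.

(** Conjugacy in one coordinate: the prior is a multiple of the kernel with exponents w + 1 and v +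
    w, and the factor adds d and n to them, which gives the exponents belonging to v + n - d and w +
    d. The constant is the ratio of the two normalizing constants. *)
Lemma integral_kern_HIG {R : realType} {d0 : measure_display} {T : measurableType d0}
    (P : probability T R) (X : T -> R) (m : nat) (v w n d : R) :
  (0 < m)%N -> 0 < v -> 0 < w -> 0 < v + n - d -> 0 < w + d ->
  measurable_fun setT X ->
  (forall B, measurable B -> P (X @^-1` B) = HIG m v w B) ->
  exists2 C : R, 0 < C & forall B, measurable B ->
  (\int[P]_(t in X @^-1` B) (kern (m%:R - 1) d n (X t))%:E
    = C%:E * HIG m (v + n - d) (w + d) B)%E.
Proof.
move=> m0 v0 w0 v'0 w'0 mX QE.
have [C0 _] := integral_HIG_kern m v w m0 v0 w0.
have [C'0 _] := integral_HIG_kern m _ _ m0 v'0 w'0.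
exists (HIG_const m v w / HIG_const m (v + n - d) (w + d)); first by rewrite divr_gt0.
move=> B mB.
(* [lebesgue_measure] lives on [measurableTypeR R], which has the same measurable
   sets as [R] but is a different [measurableType]. *)
pose X' : T -> measurableTypeR R := X.
have mX' : measurable_fun setT X' by exact: mX.
pose X'm : {mfun T >-> measurableTypeR R} := HB.pack X' (isMeasurableFun.Build _ _ _ _ _ mX').
have mk : measurable_fun (setT : set (measurableTypeR R)) (EFin \o kern (m%:R - 1) d n).
  by apply/measurable_EFinP; exact: measurable_kern.
have k0 s : (0 <= (kern (m%:R - 1) d n s)%:E)%E by rewrite lee_fin ltW// kern_gt0.
transitivity (\int[distribution P X'm]_(s in B) (kern (m%:R - 1) d n s)%:E)%E.
  by rewrite ge0_integral_pushforward//; exact: measurable_funTS.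
rewrite (@integral_density _ _ _ (distribution P X'm) lebesgue_measure
  `]0%R, +oo[%classic (HIG_pdf m v w))//.
- rewrite /HIG -ge0_integralZl//=; last 4 first.
  - exact: measurableI.
  - by apply/measurable_EFinP; exact: measurable_HIG_pdf.
  - by move=> s _; rewrite lee_fin HIG_pdf_ge0.
  - by rewrite lee_fin divr_ge0// ltW.
  apply: eq_integral => s _; rewrite -!EFinM !HIG_pdfE//.
  rewrite (_ : w + d + 1 = d + (w + 1)); last by ring.
  rewrite (_ : v + n - d + (w + d) = n + (v + w)); last by ring.
  rewrite -(kernD _ d n); move: (s ^+ 2)^-1 => y; congr EFin.
  by field; rewrite gt_eqF.
- exact: measurable_HIG_pdf.
- by move=> s; exact: HIG_pdf_ge0.
Qed.

(** * Independence *)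

(* [G] may generate a smaller sigma-algebra than that of [T]: the map
   t |-> (X t, t) into R * g_sigma_algebraType G has a product law, and the claim
   is Tonelli's theorem. *)
Lemma indep_integralM {d : measure_display} {T : measurableType d} {R : realType}
    (P : probability T R) (X : T -> R) (G : set (set T)) (phi : R -> \bar R)
    (Psi : T -> \bar R) :
  measurable_fun setT X -> G `<=` measurable ->
  (forall B D, measurable B -> <<s G >> D ->
    P (X @^-1` B `&` D) = (P (X @^-1` B) * P D)%E) ->
  measurable_fun setT phi -> (forall s, (0 <= phi s)%E) ->
  measurable_fun [set: g_sigma_algebraType G] (Psi : g_sigma_algebraType G -> \bar R) ->
  (forall t, (0 <= Psi t)%E) ->
  (\int[P]_t (phi (X t) * Psi t) = \int[P]_t phi (X t) * \int[P]_t Psi t)%E.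
Proof.
move=> mX mG indep mphi phi0 mPsi Psi0.
pose T' := g_sigma_algebraType G.
pose Y : T -> T' := fun t => t.
have sGm : <<s G >> `<=` measurable.
  by apply: smallest_sub => //; exact: sigma_algebra_measurable.
have mY : measurable_fun setT Y.
  by move=> _ D mD; rewrite setTI; exact: sGm.
pose Xm : {mfun T >-> R} := HB.pack X (isMeasurableFun.Build _ _ _ _ _ mX).
pose Ym : {mfun T >-> T'} := HB.pack Y (isMeasurableFun.Build _ _ _ _ _ mY).
pose Z t := (X t, Y t).
have mZ : measurable_fun setT Z by exact: measurable_fun_pair.
pose Zm : {mfun T >-> (R * T')%type} := HB.pack Z (isMeasurableFun.Build _ _ _ _ _ mZ).
pose F (st : R * T') : \bar R := (phi st.1 * Psi st.2)%E.
have mF : measurable_fun setT F.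
  apply: emeasurable_funM; first exact: measurableT_comp.
  by apply: measurableT_comp mPsi _.
have F0 st : (0 <= F st)%E by exact: mule_ge0.
(* By [indep] the joint law has product values on rectangles, and these determine it. *)
have prodE (A : set (R * T')) : measurable A ->
    distribution P Zm A = (distribution P Xm \x distribution P Ym)%E A.
  move=> mA; apply/esym; exact: product_measure_unique.
transitivity (\int[distribution P Zm]_st F st)%E.
  by rewrite ge0_integral_distribution.
rewrite (eq_measure_integral (distribution P Xm \x distribution P Ym)%E); last first.
  by move=> A mA _; exact: prodE.
rewrite fubini_tonelli1// /fubini_F /F /=.
under eq_integral do rewrite ge0_integralZl//.
rewrite ge0_integralZr//; last exact: integral_ge0.
by rewrite !ge0_integral_distribution.
Qed.

(** With [phi] cut off outside [B] and [Psi] outside [D], all integrals extend to the whole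
    space. *)
Lemma indep_integralM_in {d : measure_display} {T : measurableType d} {R : realType}
    (P : probability T R) (X : T -> R) (G : set (set T)) (phi : R -> \bar R)
    (Psi : T -> \bar R) (B : set R) (D : set T) :
  measurable_fun setT X -> G `<=` measurable ->
  (forall B D, measurable B -> <<s G >> D ->
    P (X @^-1` B `&` D) = (P (X @^-1` B) * P D)%E) ->
  measurable_fun setT phi -> (forall s, (0 <= phi s)%E) ->
  measurable_fun [set: g_sigma_algebraType G] (Psi : g_sigma_algebraType G -> \bar R) ->
  (forall t, (0 <= Psi t)%E) -> measurable B -> <<s G >> D ->
  (\int[P]_(t in X @^-1` B `&` D) (phi (X t) * Psi t) =
   \int[P]_(t in X @^-1` B) phi (X t) * \int[P]_(t in D) Psi t)%E.
Proof.
move=> mX mG indep mphi phi0 mPsi Psi0 mB mD.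
rewrite integral_mkcond [X in (X * _)%E]integral_mkcond [X in (_ * X)%E]integral_mkcond.
have patchX t : ((fun t => phi (X t)) \_ (X @^-1` B)) t = (phi \_ B) (X t).
  by rewrite !patchE.
under [X in (X * _)%E]eq_integral do rewrite patchX.
rewrite -(@indep_integralM _ _ _ _ X G (phi \_ B) (Psi \_ D))//.
- apply: eq_integral => t _; rewrite !patchE in_setI.
  rewrite (_ : (t \in X @^-1` B) = (X t \in B))//.
  by case: (X t \in B); case: (t \in D) => //=; rewrite ?mule0 ?mul0e.
- by apply/(measurable_restrictT _ mB); exact: measurable_funTS.
- by move=> s; rewrite patchE; case: ifP.
- apply/(@measurable_restrictT _ _ (g_sigma_algebraType G) _ D _ mD).
  exact: measurable_funTS.
- by move=> s; rewrite patchE; case: ifP.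
Qed.

(** Uniqueness of measures: D |-> P (E [&] D) and D |-> P E * P D are finite measures that agree on
    a generating family closed under intersection. *)
Lemma mutually_independent_others {d : measure_display} {T : measurableType d}
    {R : realType} (P : probability T R) {I : finType} (S : I -> set (set T)) (i0 : I) :
  mutually_independent P S ->
  (forall i, S i `<=` measurable) -> (forall i, S i setT) ->
  (forall i, setI_closed (S i)) ->
  forall E D, S i0 E -> <<s \bigcup_(i in [set i | i != i0]) S i >> D ->
  P (E `&` D) = (P E * P D)%E.
Proof.
move=> ind Sm ST SI E D SE sD.
(* Each member takes one event from every family but that of [i0]; [setT] in the other slots
   recovers a single event. *)
pose G := [set \bigcap_(i in [set i | i != i0]) F i |
           F in [set F : I -> set T | forall i, S i (F i)]].
have mE : measurable E by exact: (Sm i0).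
have Gm : G `<=` measurable.
  move=> _ [F SF <-]; apply: fin_bigcap_measurable; first exact: finite_finset.
  by move=> i _; exact: (Sm i).
have GI : setI_closed G.
  move=> _ _ [F SF <-] [F' SF' <-]; exists (fun i => F i `&` F' i).
    by move=> i; apply: SI.
  by rewrite bigcapI.
have GT : G setT.
  exists (fun=> setT); first by move=> i; exact: ST.
  by rewrite bigcapT.
have sub : <<s \bigcup_(i in [set i | i != i0]) S i >> `<=` <<s G >>.
  apply: smallest_sub; first exact: smallest_sigma_algebra.
  move=> A [i /= ii0 SA]; apply: sub_sigma_algebra.
  exists (fun k => if k == i then A else setT).
    by move=> k; case: eqP => // ->.
  apply/seteqP; split => t.
    by move=> /(_ i ii0); rewrite eqxx.
  by move=> At k _; case: ifP.
rewrite setIC muleC.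
have PE0 : (0 <= fine (P E)) by rewrite fine_ge0.
pose m2 := mscale (NngNum PE0) P.
have m2E A : measurable A -> m2 A = (P A * P E)%E.
  by move=> mA; rewrite /m2 /mscale /= fineK ?fin_num_measure// muleC.
rewrite -m2E; last first.
  by move: sD; apply: smallest_sub;
    [exact: sigma_algebra_measurable|move=> A [i _]; exact: Sm].
pose m1 := mrestr P mE.
apply: (@g_sigma_algebra_measure_unique _ _ _ G Gm (fun=> setT) _ _ m1 m2 GI) => //.
- by rewrite bigcup_const//; exists 0%N.
- move=> _ [F SF <-]; apply: etrans; last by apply/esym/m2E/Gm; exists F.
  rewrite muleC.
  transitivity (P ((\bigcap_(i in [set i | i != i0]) F i) `&` E)); first by [].
  (* With [E] in slot [i0], independence applies once to all indices and once to those other than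
     [i0]. *)
  pose F' i := if i == i0 then E else F i.
  have SF' i : S i (F' i) by rewrite /F'; case: eqP => [->|_].
  have -> : (\bigcap_(i in [set i | i != i0]) F i) `&` E =
      \bigcap_(i in [set` [set: I]%SET]) F' i.
    apply/seteqP; split=> [t [tF tE] i _|t tF'].
      by rewrite /F'; case: eqP => [//|/eqP]; exact: tF.
    split=> [i ii0|].
      by have := tF' i; rewrite /F' (negbTE ii0) /= inE; apply.
    by have := tF' i0; rewrite /F' eqxx /= inE; apply.
  have -> : \bigcap_(i in [set i | i != i0]) F i = \bigcap_(i in [set` (~: [set i0])%SET]) F i.
    by congr bigcap; apply/seteqP; split => i /=; rewrite !inE.
  rewrite !ind// (bigD1 i0) ?inE//= /F' eqxx; congr (_ * _)%E.
  apply: eq_big => [i|i]; first by rewrite !inE.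
  by case/andP => _ /negbTE ->.
- move=> k; suff : (P (setT `&` E) < +oo)%E by [].
  rewrite setTI.
  by rewrite (le_lt_trans (probability_le1 P mE))// ltry.
- exact: sub.
Qed.

(** * The Hamming likelihood as a product of kernels *)

Lemma kern_prod {R : realType} (k s : R) n (b : 'I_n -> R) :
  \prod_(i < n) kern k (b i) 1 s = kern k (\sum_(i < n) b i) n%:R s.
Proof.
elim: n b => [|n IH] b.
  by rewrite !big_ord0 /kern !mul0r subr0 oppr0 expR0.
by rewrite !big_ord_recr/= IH kernD natr1.
Qed.

(** At each coordinate the normalizing factor supplies the exponent 1 of the base, and a mismatch
    supplies exp (-1/s). *)
Lemma hamming_pmfE {R : realType} {p : nat} {A : 'I_p -> finType}
    (c x : {dffun forall j, A j}) (s : 'I_p -> R) : (forall j, (0 < #|A j|)%N) ->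
  hamming_pmf c s x = \prod_(j < p) kern (#|A j|%:R - 1) (1 - (x j == c j)%:R) 1 (s j).
Proof.
move=> hA; have k0 j : 0 <= #|A j|%:R - 1 :> R by rewrite subr_ge0 ler1n.
rewrite /hamming_pmf div1r -prodfV -sumrN expR_sum -big_split/=.
apply: eq_bigr => j _; rewrite kernE//; congr (_ * _).
by rewrite powR_inv1// ltW// kern_base_gt0.
Qed.

Lemma hamming_prodE {R : realType} {p n : nat} {A : 'I_p -> finType}
    (c : {dffun forall j, A j}) (a : 'I_n -> {dffun forall j, A j}) (s : 'I_p -> R) :
  (forall j, (0 < #|A j|)%N) ->
  \prod_(i < n) hamming_pmf c s (a i) =
  \prod_(j < p) kern (#|A j|%:R - 1) (n%:R - \sum_(i < n) (a i j == c j)%:R) n%:R (s j).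
Proof.
move=> hA; under eq_bigr do rewrite hamming_pmfE//.
rewrite exchange_big/=; apply: eq_bigr => j _; rewrite kern_prod sumrB.
by rewrite sumr_const card_ord.
Qed.

Lemma measurable_prod_kern {R : realType} {d : measure_display} {T : measurableType d}
   (p : nat) (P : pred 'I_p) (X : 'I_p -> T -> R) (k b a : 'I_p -> R) :
  (forall j, P j -> measurable_fun setT (X j)) ->
  measurable_fun setT (fun t => \prod_(j < p | P j) kern (k j) (b j) (a j) (X j t)).
Proof.
move=> mX; under eq_fun do rewrite big_mkcond.
apply: measurable_prod => j _; case: (boolP (P j)) => // Pj.
by apply: measurableT_comp; [exact: measurable_kern|exact: mX].
Qed.

(** * Conditioning on fixed values of the data and the center *)

(** The sets whose trace on [W] is that of a member of <<s G' >> form a sigma-algebra. This serves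
    to discard the data generators where the data are constant. *)
Lemma sigma_trace {T : Type} (G G' : set (set T)) (W : set T) :
  (forall A, G A -> exists2 A', <<s G' >> A' & A `&` W = A' `&` W) ->
  forall D, <<s G >> D -> exists2 D', <<s G' >> D' & D `&` W = D' `&` W.
Proof.
move=> GG'; have [s0 sC sU] := smallest_sigma_algebra setT G'.
apply: smallest_sub => //; split.
- by exists set0.
- move=> A [A' sA' AA']; exists (setT `\` A').
    exact: sC.
  rewrite !setTD; apply/seteqP; split => t [At Wt]; split => // At'; apply: At.
    by have [] : (A `&` W) t by rewrite AA'.
  by have [] : (A' `&` W) t by rewrite -AA'.
- move=> F FF; have /choice[F' FF'] k : exists A', <<s G' >> A' /\ F k `&` W = A' `&` W.
    by have [A' ? ?] := FF k; exists A'.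
  exists (\bigcup_k F' k); first by apply: sU => k; case: (FF' k).
  by rewrite !setI_bigcupl; apply: eq_bigcupr => k _; case: (FF' k).
Qed.

(* Restricted to the event that the data equal [a] and the center equals [c0],
   the likelihood factors over the coordinates, and the factor at [j] turns the
   prior of [sigma j] into a multiple of its posterior. *)
Lemma cond_given_data {R : realType} {p : nat} {A : 'I_p -> finType}
    (v w : R) {d : measure_display} {T : measurableType d} (P : probability T R)
    (sigma : 'I_p -> {RV P >-> R}) (c : T -> {dffun forall j, A j})
    (n : nat) (x : 'I_n -> T -> {dffun forall j, A j}) (j : 'I_p)
    (a : 'I_n -> {dffun forall j, A j}) (c0 : {dffun forall j, A j})
    (B : set R) (D : set T) :
  (forall j, (0 < #|A j|)%N) -> 0 < v -> 0 < w ->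
  hamming_model v w sigma c x ->
  measurable B ->
  <<s \bigcup_(o in [set o | o != Some j])
      (if o is Some k then real_events (sigma k) else finite_events c) >> D ->
  let agree : R := \sum_(i < n) (a i j == c0 j)%:R in
  let W := [set t | forall i, x i t = a i] `&` c @^-1` [set c0] in
  P (sigma j @^-1` B `&` (D `&` W)) =
  (P (D `&` W) * HIG #|A j| (v + agree) (w + n%:R - agree) B)%E.
Proof.
move=> hA v0 w0 [mc mx ind prior iid] mB sD agree W.
set S := fun o : option 'I_p => if o is Some k then real_events (sigma k) else finite_events c.
have Sm o : S o `<=` measurable.
  case: o => [k|]; last exact: mc.
  move=> E [C mC <-]; exact: (measurable_funP (sigma k)).
have ST o : S o setT.
  by case: o => [k|]; exists setT => //; rewrite preimage_setT setTI.
have SI o : setI_closed (S o).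
  case: o => [k|] E1 E2 [C1 mC1 <-] [C2 mC2 <-]; exists (C1 `&` C2).
  - exact: measurableI.
  - by rewrite preimage_setI !setTI.
  - by [].
  - by rewrite preimage_setI !setTI.
set G := \bigcup_(o in [set o | o != Some j]) S o.
have Gm : G `<=` measurable by move=> C [i _]; exact: Sm.
have agree_le : agree <= n%:R.
  rewrite -[n in n%:R]card_ord -sumr_const ler_sum// => i _.
  by rewrite lern1 leq_b1.
have agree_ge0 : 0 <= agree by exact: sumr_ge0.
(* The number of mismatches at coordinate [l]. *)
pose dl l : R := n%:R - \sum_(i < n) (a i l == c0 l)%:R.
pose k l : R := #|A l|%:R - 1.
have dj : dl j = n%:R - agree by [].
have v'E : v + agree = v + n%:R - dl j by rewrite dj; ring.
have w'E : w + n%:R - agree = w + dl j by rewrite dj; ring.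
have v'0 : 0 < v + agree by rewrite ltr_wpDr.
have w'0 : 0 < w + n%:R - agree by rewrite -addrA ltr_wpDr// subr_ge0.
have priorj C : measurable C -> P (sigma j @^-1` C) = HIG #|A j| v w C.
  by move=> mC; rewrite -(prior j)//.
have mj : measurable_fun setT (sigma j) by exact: measurable_funP.
have [|| K K0 intj] := @integral_kern_HIG R _ _ P (sigma j) _ v w n%:R (dl j)
    (hA j) v0 w0 _ _ mj priorj.
  by rewrite -v'E.
  by rewrite -w'E.
rewrite -v'E -w'E in intj.
(* The factors at the other coordinates, a function of the scales other than [sigma j]. *)
pose Psi t := (\prod_(l < p | l != j) kern (k l) (dl l) n%:R (sigma l t))%:E.
have Psi0 t : (0 <= Psi t)%E.
  by rewrite lee_fin prodr_ge0// => l _; rewrite ltW// kern_gt0.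
have mPsi : measurable_fun [set: g_sigma_algebraType G]
    (Psi : g_sigma_algebraType G -> \bar R).
  apply/measurable_EFinP.
  apply: (@measurable_prod_kern R _ (g_sigma_algebraType G) p (fun l => l != j)
    (fun l => sigma l : T -> R)) => l lj _ C mC.
  rewrite setTI; apply: sub_sigma_algebra.
  by exists (Some l) => //; exists C => //; rewrite setTI.
have indj C E : measurable C -> <<s G >> E ->
    P (sigma j @^-1` C `&` E) = (P (sigma j @^-1` C) * P E)%E.
  move=> mC; apply: (mutually_independent_others P S (Some j)) => //.
  by exists C => //; rewrite setTI.
pose D' := D `&` c @^-1` [set c0].
have sD' : <<s G >> D'.
  apply: (@measurableI _ (g_sigma_algebraType G)) => //; apply: sub_sigma_algebra.
  by exists None => //; exists [set c0] => //; rewrite setTI.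
set H := finite_events c `|` _ in iid.
have GH : <<s G >> `<=` <<s H >>.
  apply: sub_sigma_algebra2 => E [[l|] /= _ SE]; first by right; exists l.
  by left.
(* The conditional law of the data is applied to the event sigma_j in C, D and c = c0; independence
   then splits the integral. Only the HIG factor depends on [C]. *)
have key C : measurable C -> P (sigma j @^-1` C `&` (D `&` W)) =
    (K%:E * HIG #|A j| (v + agree) (w + n%:R - agree) C * \int[P]_(t in D') Psi t)%E.
  move=> mC; have [_ /(_ (sigma j @^-1` C `&` D'))] := iid a.
  rewrite (_ : _ `&` (_ `&` D') = sigma j @^-1` C `&` (D `&` W)); last first.
    by rewrite /W /D' [D `&` (_ `&` _)]setICA setICA.
  move=> -> //; last first.
    apply: (@measurableI _ (g_sigma_algebraType H)); last exact: GH.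
    apply: sub_sigma_algebra; right; exists j => //.
    by exists C => //; rewrite setTI.
  have mk : measurable_fun setT (EFin \o kern (k j) (dl j) n%:R).
    by apply/measurable_EFinP; exact: measurable_kern.
  have k0 s : (0 <= (EFin \o kern (k j) (dl j) n%:R) s)%E by rewrite lee_fin ltW// kern_gt0.
  rewrite -intj//.
  apply: etrans (indep_integralM_in P (sigma j) G _ Psi C D' mj Gm indj
    mk k0 mPsi Psi0 mC sD').
  apply: eq_integral => t; rewrite inE => -[_ [_ /= ct]].
  rewrite ct hamming_prodE// (bigD1 j)//=.
have [Q QE] := HIG_probability #|A j| _ _ (hA j) v'0 w'0.
(* Since the posterior has mass one, taking C = [setT] identifies the remaining constant as P (D [&]
   W). *)
have := key setT measurableT; rewrite preimage_setT setTI => ->.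
rewrite key// -!QE//= probability_setT mule1.
by rewrite muleAC.
Qed.

(** * Decomposition over finitely many values *)

Lemma measurable_finite_comp {d d' : measure_display} {T : measurableType d}
    {T' : measurableType d'} {F : finType} (y : T -> F) (h : F -> T') :
  (forall u, measurable (y @^-1` [set u])) -> measurable_fun setT (h \o y).
Proof.
move=> my _ Y mY; rewrite setTI.
rewrite (_ : _ @^-1` Y = \bigcup_(u in h @^-1` Y) (y @^-1` [set u])).
  by apply: fin_bigcup_measurable => //; exact: finite_finset.
by apply/seteqP; split => [t Yt|t [u Yu /= ->]//]; exists (y t).
Qed.

Lemma integral_finite_partition {d : measure_display} {T : measurableType d}
    {R : realType} (mu : {measure set T -> \bar R}) {F : finType} (y : T -> F)
    (f : T -> \bar R) (D : set T) :
  (forall u, measurable (y @^-1` [set u])) -> measurable D ->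
  measurable_fun setT f -> (forall t, (0 <= f t)%E) ->
  (\int[mu]_(t in D) f t = \sum_(u : F) \int[mu]_(t in D `&` y @^-1` [set u]) f t)%E.
Proof.
move=> my mD mf f0.
have DE : D = \big[setU/set0]_(u <- index_enum F) (D `&` y @^-1` [set u]).
  apply/seteqP; split => t.
    by move=> Dt; rewrite (bigD1 (y t))//=; left.
  by rewrite -bigcup_seq => -[u _ []].
rewrite [in LHS]DE ge0_integral_bigsetU//.
- by move=> u; exact: measurableI.
- exact: index_enum_uniq.
- by apply/trivIsetP => u u' _ _ /eqP uu'; apply/seteqP; split => // t [[_ /= yu] [_ /= yu']];
    apply: uu'; rewrite -yu -yu'.
- exact: measurable_funTS.
Qed.

(** * The full conditional distribution of a scale *)

Theorem proposition2 (R : realType) (p : nat) (hp : (0 < p)%N)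
    (A : 'I_p -> finType) (hA : forall j, (0 < #|A j|)%N)
    (v w : R) (hv : 0 < v) (hw : 0 < w) :
  (forall j, is_pdf_on_pos (HIG_pdf #|A j| v w)) /\
  (forall (d : measure_display) (T : measurableType d) (P : probability T R)
     (sigma : 'I_p -> {RV P >-> R}) (c : T -> {dffun forall j, A j})
     (n : nat) (x : 'I_n -> T -> {dffun forall j, A j}),
   hamming_model v w sigma c x ->
   forall j : 'I_p,
   let agree t : R := \sum_(i < n) (x i t j == c t j)%:R in
   let vstar t : R := v + agree t in
   let wstar t : R := w + n%:R - agree t in
   (forall t, 0 < vstar t /\ 0 < wstar t) /\
   is_cond_distribution P (full_conditioning sigma c x j)
     (sigma j) (fun t => HIG #|A j| (vstar t) (wstar t))).
Proof.
split=> [j|d T P sigma c n x hm j agree vstar wstar]; first exact: HIG_is_pdf.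
have sum_gt0 (b : 'I_n -> bool) : 0 < v + \sum_(i < n) (b i)%:R /\
    0 < w + n%:R - \sum_(i < n) (b i)%:R.
  split; first by rewrite ltr_wpDr// sumr_ge0.
  rewrite -addrA ltr_wpDr// subr_ge0 -[n in n%:R]card_ord -sumr_const.
  by apply: ler_sum => i _; rewrite lern1 leq_b1.
have vw0 t : 0 < vstar t /\ 0 < wstar t by exact: sum_gt0.
split=> //; split=> [t|B mB]; first by case: (vw0 t) => *; exact: HIG_probability.
set G := full_conditioning sigma c x j.
have [mc mx _ _ _] := hm.
have Gm : G `<=` measurable.
  move=> E [[[i _]|]|[k _]].
  - exact: mx.
  - exact: mc.
  - by move=> [C mC <-]; exact: (measurable_funP (sigma k)).
have sGm : <<s G >> `<=` measurable.
  by apply: smallest_sub => //; exact: sigma_algebra_measurable.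
(* The posterior parameters depend on [t] only through the data and the center, whose joint value
   ranges over a finite type. *)
pose y t : {ffun 'I_n -> {dffun forall j, A j}} * {dffun forall j, A j} :=
  ([ffun i => x i t], c t).
pose agr (u : {ffun 'I_n -> {dffun forall j, A j}} * {dffun forall j, A j}) : R :=
  \sum_(i < n) (u.1 i j == u.2 j)%:R.
pose h u : \bar R := HIG #|A j| (v + agr u) (w + n%:R - agr u) B.
have qE t : HIG #|A j| (vstar t) (wstar t) B = h (y t).
  rewrite /h /vstar /wstar (_ : agr (y t) = agree t)//.
  by apply: eq_bigr => i _; rewrite ffunE.
have yE u : y @^-1` [set u] = [set t | forall i, x i t = u.1 i] `&` c @^-1` [set u.2].
  case: u => a c0; apply/seteqP; split => t /=.
    by case=> <- <-; split => // i; rewrite ffunE.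
  by move=> [xa <-]; congr pair; apply/ffunP => i; rewrite ffunE.
have sy u : <<s G >> (y @^-1` [set u]).
  rewrite yE; apply: (@measurableI _ (g_sigma_algebraType G)).
    rewrite (_ : [set t | _] = \bigcap_i (x i @^-1` [set u.1 i])); last first.
      by apply/seteqP; split => t xt i => [_|]; exact: xt.
    apply: (@fin_bigcap_measurable _ (g_sigma_algebraType G)) => [|i _].
      exact: finite_finset.
    apply: sub_sigma_algebra; left; left; exists i => //.
    by exists [set u.1 i] => //; rewrite setTI.
  apply: sub_sigma_algebra; left; right.
  by exists [set u.2] => //; rewrite setTI.
have my u : measurable (y @^-1` [set u]) by exact: sGm.
have h0 u : (0 <= h u)%E.
  apply: integral_ge0 => s _; rewrite lee_fin.
  by have [] := sum_gt0 (fun i => u.1 i j == u.2 j); exact: HIG_pdf_ge0.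
under eq_fun do rewrite qE.
split; first exact: (@measurable_finite_comp _ _ (g_sigma_algebraType G)).
move=> D sD; have mD : measurable D by exact: sGm.
have mX : measurable (sigma j @^-1` B).
  by rewrite -[X in measurable X]setTI; exact: (measurable_funP (sigma j)).
have mXD : measurable (sigma j @^-1` B `&` D) by exact: measurableI.
(* Both sides are split over the values of [y], the probability on the left being the integral of 1;
   on each fiber the posterior is constant. *)
rewrite (integral_finite_partition _ y)//; last exact: measurable_finite_comp.
rewrite -[LHS]mul1e -(integral_cst P)// (integral_finite_partition _ y)//.
apply: eq_bigr => u _; rewrite integral_cst ?mul1e//; last exact: measurableI.
rewrite (_ : integral _ _ _ = \int[P]_(t in D `&` y @^-1` [set u]) cst (h u) t)%E; last first.
  by apply: eq_integral => t; rewrite inE => -[_ /= ->].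
rewrite integral_cst//; last exact: measurableI.
set S := \bigcup_(o in [set o | o != Some j])
   (if o is Some k then real_events (sigma k) else finite_events c).
(* Where the data are fixed, [D] coincides with an event generated by the center and the other
   scales alone. *)
have [D' sD' DD'] : exists2 D', <<s S >> D' &
    D `&` [set t | forall i, x i t = u.1 i] = D' `&` [set t | forall i, x i t = u.1 i].
  apply: sigma_trace sD => E [[[i _ [C _ <-]]|cE]|[k /= kj kE]].
  (* A data event contains all or nothing of this fiber, according to whether the fixed value lies
     in [C]. *)
  - have [Cu|Cu] := pselect (C (u.1 i)).
      exists setT; first exact: (@measurableT _ (g_sigma_algebraType S)).
      apply/seteqP; split => t [_ xt]; split => //=.
      by split => //=; rewrite xt.
    exists set0; first by have [] := smallest_sigma_algebra setT S.
    by apply/seteqP; split => t [//= [_ Ct] xt]; move: Ct; rewrite /= xt.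
  - by exists E => //; apply: sub_sigma_algebra; exists None.
  - by exists E => //; apply: sub_sigma_algebra; exists (Some k).
rewrite -setIA.
have -> : D `&` y @^-1` [set u] = D' `&` y @^-1` [set u] by rewrite yE !setIA DD'.
have := cond_given_data v w P sigma c n x j u.1 u.2 B D' hA hv hw hm mB sD'.
by rewrite /= -yE => ->; rewrite muleC.
Qed.
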